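(* Let $G$ be a singleton-partition graph of order $n$ with $\delta(G)=1$ that contains no full vertex. Then the $G$-SC chain is one of the following chains, where $H_1$ denotes some graph in the family $\mathcal{H}_1$: (a) $G\to H_1$; (b) $G\to C_4\to K_4\to\overline{K}_4$; (c) $G\to K_{2,n-2}\to K_1+K_{1,n-2}$.
   Context: All graphs are finite and simple. A full vertex is a vertex adjacent to all other vertices. A set $D\subseteq V$ is dominating if every vertex not in $D$ has a neighbor in $D$. Two disjoint sets $A,B\subseteq V$ form a coalition if neither is dominating but $A\cup B$ is. A coalition partition of $G$ is a partition $\mathcal{P}$ of $V$ such that every member is either a dominating set of cardinality 1, or is not dominating and forms a coalition with some other member. The coalition graph ${\rm CG}(G,\mathcal{P})$ has vertex set $\mathcal{P}$, two members adjacent iff they form a coalition. $\Gamma_1$ is the partition of $V$ into singletons; $G$ is a singleton-partition graph (SP-graph) if $\Gamma_1$ is a coalition partition of $G$. A singleton coalition graph chain with initial graph $G_1$ is a sequence $G_1\to G_2\to\cdots$ where each graph having a successor is an SP-graph and its successor is ${\rm CG}(G_i,\Gamma_1)$ (up to isomorphism). The $G$-SC chain is such a chain starting at $G$ of maximum possible length (it continues as long as the current graph is an SP-graph). $+$ denotes the join of graphs, $\overline{K}_m$ the edgeless graph on $m$ vertices. The family $\mathcal{H}_1$: all bipartite graphs with parts $A_1=\{x_1,y_1\}$ and $B_1=P_1\cup\{w_1\}\cup Q_1$, where $|P_1\cup Q_1|\ge1$ and if $Q_1\neq\emptyset$ then $|Q_1|\ge 2$; $y_1$ is adjacent to every vertex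 of $B_1$, and $x_1$ is adjacent exactly to the vertices of $P_1\cup\{w_1\}$; there are no other edges. *)

(* Defs.v *)
From mathcomp Require Import all_boot.

Set Implicit Arguments.
Unset Strict Implicit.
Unset Printing Implicit Defensive.

Record sgraph := SGraph {
  vertex :> finType;
  adj : rel vertex;
  adj_sym : symmetric adj;
  adj_irr : irreflexive adj
}.

Arguments adj {s}.

Definition iso (G H : sgraph) : Prop :=
  exists2 f : G -> H, bijective f & forall x y : G, adj (f x) (f y) = adj x y.

Section Coalitions.
Variable G : sgraph.
Implicit Types (v : G) (A B D : {set G}) (P : {set {set G}}).

Definition degree v : nat := #|[set u : G | adj v u]|.

(* All degrees are smaller than #|G|, so this is the true minimum as soon as
   G has a vertex. *)
Definition min_degree : nat := \big[minn/#|G|]_(v : G) degree v.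

Definition full_vertex v : bool := [forall u : G, (u != v) ==> adj v u].

Definition dominating D : bool :=
  [forall v : G, (v \notin D) ==> [exists u in D, adj v u]].

Definition coalition A B : bool :=
  [&& [disjoint A & B], ~~ dominating A, ~~ dominating B
    & dominating (A :|: B)].

Definition coalition_partition P : bool :=
  partition P [set: G] &&
  [forall A in P,
     (dominating A && (#|A| == 1))
     || (~~ dominating A && [exists B in P :\ A, coalition A B])].

Lemma coalition_sym : symmetric coalition.
Proof.
move=> A B; rewrite /coalition disjoint_sym setUC.
by rewrite [~~ dominating A && _]andbCA.
Qed.

Lemma coalition_irr : irreflexive coalition.
Proof.
by move=> A; rewrite /coalition setUid; case: (dominating A); rewrite /= ?andbF.
Qed.

Definition singleton_partition : {set {set G}} := [set [set v] | v : G].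

Definition SP_graph : bool := coalition_partition singleton_partition.

End Coalitions.

Definition coalition_graph (G : sgraph) (P : {set {set G}}) : sgraph :=
  @SGraph {A : {set G} | A \in P} (fun A B => coalition (val A) (val B))
    (fun A B => coalition_sym (val A) (val B))
    (fun A => coalition_irr (val A)).

Definition SC_step (G H : sgraph) : Prop :=
  SP_graph G /\ iso H (coalition_graph (singleton_partition G)).

(* singleton_coalition_chain G [:: G2; ...; Gk] says that G -> G2 -> ... -> Gk
   is a singleton coalition graph chain with initial graph G. *)
Fixpoint singleton_coalition_chain (G : sgraph) (s : seq sgraph) : Prop :=
  if s is H :: s' then SC_step G H /\ singleton_coalition_chain H s' else True.

(* G followed by s is the G-SC chain, i.e. a chain of maximum length. When a
   chain starting at G can be continued forever, it has arbitrarily long finite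
   prefixes, and no finite s qualifies. *)
Definition SC_chain (G : sgraph) (s : seq sgraph) : Prop :=
  singleton_coalition_chain G s /\
  forall s', singleton_coalition_chain G s' -> size s' <= size s.

Section Constructions.

Lemma neq_sym (T : finType) : symmetric (fun x y : T => x != y).
Proof. by move=> x y; rewrite eq_sym. Qed.

Lemma neq_irr (T : finType) : irreflexive (fun x y : T => x != y).
Proof. by move=> x; rewrite eqxx. Qed.

Definition complete_graph (n : nat) : sgraph :=
  SGraph (@neq_sym 'I_n) (@neq_irr 'I_n).

Definition edgeless_graph (n : nat) : sgraph :=
  @SGraph 'I_n (fun _ _ => false) (fun _ _ => erefl) (fun _ => erefl).

Definition cycle_adj (n : nat) : rel 'I_n := fun i j =>
  (i != j) && ((val j == i.+1 %% n) || (val i == j.+1 %% n)).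

Lemma cycle_adj_sym n : symmetric (@cycle_adj n).
Proof. by move=> i j; rewrite /cycle_adj eq_sym orbC. Qed.

Lemma cycle_adj_irr n : irreflexive (@cycle_adj n).
Proof. by move=> i; rewrite /cycle_adj eqxx. Qed.

(* This is C_n for n >= 3. *)
Definition cycle_graph (n : nat) : sgraph :=
  SGraph (@cycle_adj_sym n) (@cycle_adj_irr n).

Definition join_adj (G H : sgraph) : rel (G + H)%type := fun a b =>
  match a, b with
  | inl x, inl y => adj x y
  | inr x, inr y => adj x y
  | _, _ => true
  end.

Lemma join_adj_sym G H : symmetric (@join_adj G H).
Proof. by case=> x [] y //=; exact: adj_sym. Qed.

Lemma join_adj_irr G H : irreflexive (@join_adj G H).
Proof. by case=> x /=; exact: adj_irr. Qed.

Definition join (G H : sgraph) : sgraph :=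
  @SGraph (G + H)%type _ (@join_adj_sym G H) (@join_adj_irr G H).

Definition complete_bipartite (m n : nat) : sgraph :=
  join (edgeless_graph m) (edgeless_graph n).

End Constructions.

Definition in_H1 (H : sgraph) : Prop :=
  exists (x y w : H) (P Q : {set H}),
    let A := [set x; y] in
    let B := P :|: [set w] :|: Q in
    [/\ x != y, A :|: B = [set: H] & [disjoint A & B]] /\
    [/\ w \notin P, w \notin Q & [disjoint P & Q]] /\
    (1 <= #|P :|: Q|) /\ (Q != set0 -> 2 <= #|Q|) /\
    [/\ forall v, adj x v = (v \in P :|: [set w]),
        forall v, adj y v = (v \in B)
      & {in B &, forall u v, ~~ adj u v}].

(* Main.v *)
Require Import Defs.
From mathcomp Require Import all_boot.

(** A leaf [x] with neighbour [y] forces every dominating pair to meet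
    [{x, y}]. As no vertex is full, [{x, y}] itself does not dominate, and any
    partner of [x] is also a partner of [y]; so the successor of [G] is
    bipartite with parts [{x, y}] and the rest, [y] being joined to all of the
    rest. If some vertex is not a partner of [x], then it has no partner in the
    successor and the chain stops; otherwise the successor is [K_{2,n-2}], whose
    own chain is computed directly. *)

Set Implicit Arguments.
Unset Strict Implicit.
Unset Printing Implicit Defensive.

(** * Isomorphisms and dominating sets *)

Lemma iso_sym (G H : sgraph) : iso G H -> iso H G.
Proof.
case=> f [g fK gK] fadj; exists g; first by exists f.
by move=> u v; rewrite -fadj !gK.
Qed.

Lemma iso_trans (G H K : sgraph) : iso G H -> iso H K -> iso G K.
Proof.
case=> f bij_f fadj [g bij_g gadj]; exists (g \o f); first exact: bij_comp.
by move=> u v; rewrite /= gadj fadj.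
Qed.

Lemma inj_card_iso (G H : sgraph) (f : G -> H) :
    injective f -> #|H| <= #|G| -> (forall u v, adj (f u) (f v) = adj u v) ->
  iso G H.
Proof. by move=> inj_f leHG fadj; exists f => //; exact: inj_card_bij. Qed.

Lemma dominating_imset (G H : sgraph) (f : G -> H) (D : {set G}) :
    bijective f -> (forall u v, adj (f u) (f v) = adj u v) ->
  dominating (f @: D) = dominating D.
Proof.
move=> bij_f fadj; have inj_f := bij_inj bij_f; case: bij_f => g fK gK.
apply/forallP/forallP => domD v; apply/implyP.
  move=> vD; have := domD (f v); rewrite mem_imset // vD.
  case/existsP=> _ /andP[/imsetP[u uD ->]]; rewrite fadj => vu.
  by apply/existsP; exists u; rewrite uD.
rewrite -[v]gK mem_imset // => vD; have := domD (g v); rewrite vD.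
case/existsP=> u /andP[uD vu]; apply/existsP; exists (f u).
by rewrite mem_imset // uD fadj.
Qed.

Lemma dominating1 (G : sgraph) (v : G) : dominating [set v] = full_vertex v.
Proof.
apply: eq_forallb => u; rewrite inE; congr (_ ==> _).
apply/existsP/idP => [[w /andP[/set1P-> ]]|vu]; first by rewrite adj_sym.
by exists v; rewrite inE eqxx adj_sym.
Qed.

Lemma dominating2P (G : sgraph) (u v : G) :
  reflect (forall z, z != u -> z != v -> adj z u || adj z v)
          (dominating [set u; v]).
Proof.
apply: (iffP forallP) => dom z.
  move=> zu zv; have := dom z; rewrite !inE negb_or zu zv.
  by case/existsP=> w /andP[/set2P[]-> ->] //; rewrite orbT.
rewrite !inE negb_or; apply/implyP=> /andP[zu zv]; apply/existsP.
by case/orP: (dom z zu zv) => ?; [exists u | exists v]; rewrite !inE eqxx ?orbT.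
Qed.

(** * Coalitions between single vertices, and the SC step they induce *)

Definition singleton_coalition (G : sgraph) : rel G :=
  fun u v => coalition [set u] [set v].

(** A copy of the coalition graph of the singleton partition carried by the vertices of [G]
    themselves, so that later arguments avoid the subtype of blocks. *)
Definition singleton_coalition_graph (G : sgraph) : sgraph :=
  @SGraph G (@singleton_coalition G) (fun u v => coalition_sym [set u] [set v])
    (fun u => coalition_irr [set u]).

Lemma singleton_coalitionE (G : sgraph) (u v : G) :
  singleton_coalition u v =
  [&& u != v, ~~ full_vertex u, ~~ full_vertex v & dominating [set u; v]].
Proof.
by rewrite /singleton_coalition /coalition !dominating1 disjoints1 inE.
Qed.

Lemma iso_coalition_graph (G : sgraph) :
  iso (singleton_coalition_graph G) (coalition_graph (singleton_partition G)).
Proof.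
have inP (v : G) : [set v] \in singleton_partition G by exact: imset_f.
exists (fun v : G => exist _ [set v] (inP v)) => //.
apply: inj_card_bij; first by move=> u v [] /set1_inj.
by rewrite /= card_sig -(card_imset _ (@set1_inj G)); apply/eq_leq/eq_card.
Qed.

(** Singletons always form a partition into sets of size 1, so only the full-or-partner alternative
    is left. A coalition already forces its two sides to be distinct and not dominating, hence the
    bare second disjunct. *)
Lemma SP_graphP (G : sgraph) :
  reflect (forall v : G, full_vertex v \/ exists u, singleton_coalition v u)
          (SP_graph G).
Proof.
have ptn : partition (singleton_partition G) [set: G].
  apply/and3P; split.
  - apply/eqP/setP=> v; rewrite inE; apply/bigcupP; exists [set v].
      exact: imset_f.
    exact: set11.
  - apply/trivIsetP=> _ _ /imsetP[u _ ->] /imsetP[v _ ->] uv.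
    by rewrite disjoints1 inE; apply: contraNneq uv => ->.
  - by apply/imsetP=> -[v _ /setP/(_ v)]; rewrite !inE eqxx.
rewrite /SP_graph /coalition_partition ptn.
apply: (iffP forall_inP) => [SP v | SP _ /imsetP[v _ ->]].
  have /SP : [set v] \in singleton_partition G by exact: imset_f.
  rewrite dominating1; case/orP=> [/andP[] | /andP[_ /existsP[B]]].
    by left.
  by case/andP=> /setD1P[_ /imsetP[u _ ->]] vu; right; exists u.
rewrite dominating1 cards1 andbT.
case: (SP v) => [-> // | [u vu]]; have:= vu; rewrite singleton_coalitionE.
case/and4P=> nvu /[dup] nv -> _ _; rewrite (negbTE nv) /=.
apply/existsP; exists [set u]; rewrite -/(singleton_coalition v u) vu andbT.
rewrite !inE imset_f // andbT.
by apply: contraNneq nvu => /set1_inj->.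
Qed.

Lemma SC_stepP (G H : sgraph) :
  SC_step G H <-> SP_graph G /\ iso H (singleton_coalition_graph G).
Proof.
have isoG := iso_coalition_graph G.
by split=> -[SP_G isoH]; split=> //; apply: iso_trans isoH _ => //;
   exact: iso_sym.
Qed.

Lemma singleton_coalition_iso (G H : sgraph) (f : G -> H) :
    bijective f -> (forall u v, adj (f u) (f v) = adj u v) ->
  forall u v, singleton_coalition (f u) (f v) = singleton_coalition u v.
Proof.
move=> bij_f fadj u v; rewrite /singleton_coalition /coalition !disjoints1 !inE.
rewrite (bij_eq bij_f) -!(imset_set1 f) -imsetU.
by rewrite !(dominating_imset _ bij_f fadj).
Qed.

(** Successors are fixed only up to isomorphism, so continuing a chain requires moving a step from
    one representative to another. *)
Lemma SC_step_iso (G H K : sgraph) : iso G H -> SC_step G K -> SC_step H K.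
Proof.
case=> f bij_f fadj /SC_stepP[SP_G isoK].
have fsc := singleton_coalition_iso bij_f fadj.
apply/SC_stepP; split; last by apply: iso_trans isoK _; exists f.
apply/SP_graphP=> v; have [g fK gK] := bij_f; rewrite -[v]gK.
move/SP_graphP/(_ (g v)): SP_G => [|[u vu]]; last first.
  by right; exists (f u); rewrite fsc.
by rewrite -!dominating1 -(imset_set1 f) (dominating_imset _ bij_f fadj); left.
Qed.

(** * Building maximal chains backwards *)

Lemma SC_chain_nil (G : sgraph) : ~~ SP_graph G -> SC_chain G [::].
Proof. by move=> nSP; split=> // -[//|H s] [[]]; rewrite (negbTE nSP). Qed.

(** Any competing chain from [G] starts with some [K] isomorphic to [H]; its next step transfers to
    [H], so its tail is a chain from [H] and the maximality of [s] bounds it. *)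
Lemma SC_chain_cons (G H : sgraph) (s : seq sgraph) :
  SC_step G H -> SC_chain H s -> SC_chain G (H :: s).
Proof.
move=> GH [chain_s max_s]; split=> // -[//|K s'] [GK chain_s'].
apply: max_s; case: s' chain_s' => //= L s' [KL Ls']; split=> //.
apply: SC_step_iso KL; move/SC_stepP: GK => [_ isoK].
by move/SC_stepP: GH => [_ /iso_sym]; exact: iso_trans.
Qed.

(** * The explicit graphs occurring in the chains *)

Lemma complete_bipartite_iso (G : sgraph) (A : {set G}) :
    (forall u v : G, adj u v = (u \in A) (+) (v \in A)) ->
  iso (complete_bipartite #|A| #|~: A|) G.
Proof.
move=> adjE.
pose f (a : complete_bipartite #|A| #|~: A|) : G :=
  match a with inl i => enum_val i | inr j => enum_val j end.
have fA a : f a \in A = if a is inl _ then true else false.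
  case: a => i /=; first exact: enum_valP.
  by apply/negbTE; have := enum_valP i; rewrite inE.
apply: (@inj_card_iso _ _ f).
(* Membership in [A] recovers the side, and [enum_val] is injective on each side. *)
- move=> a b eq_f; have := congr1 (fun u => u \in A) eq_f; rewrite !fA.
  by case: a b eq_f => i [] j //= /enum_val_inj->.
- by rewrite card_sum !card_ord cardsC.
- by move=> a b; rewrite adjE !fA; case: a b => i [].
Qed.

Lemma cycle4_iso : iso (cycle_graph 4) (complete_bipartite 2 2).
Proof.
(* Parity is the bipartition of the 4-cycle. *)
pose A : {set cycle_graph 4} := [set i | ~~ odd (val i)].
have [cA cA'] : #|A| = 2 /\ #|~: A| = 2.
  by split; rewrite -sum1_card big_mkcond !big_ord_recl big_ord0 !inE.
apply: iso_sym; have := @complete_bipartite_iso _ A; rewrite cA cA'; apply.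
move=> u v; rewrite !inE.
by case: u v => [[|[|[|[|//]]]] ?] [[|[|[|[|//]]]] ?].
Qed.

Lemma full_vertex_complete (n : nat) (v : complete_graph n) : full_vertex v.
Proof. by apply/forallP=> u; rewrite eq_sym; apply/implyP. Qed.

Lemma SC_step_complete (n : nat) :
  SC_step (complete_graph n) (edgeless_graph n).
Proof.
apply/SC_stepP; split.
  by apply/SP_graphP=> v; left; exact: full_vertex_complete.
exists id => [|u v]; first by exists id.
by rewrite /= singleton_coalitionE full_vertex_complete /= andbF.
Qed.

Lemma edgeless4_not_SP : ~~ SP_graph (edgeless_graph 4).
Proof.
apply/negP=> /SP_graphP/(_ ord0) [/forallP/(_ ord_max) // | [u]].
rewrite singleton_coalitionE => /and4P[_ _ _ /dominating2P dom].
(* The pair consisting of 0 and [u] leaves 1 undominated, or 2 when [u] is 1. *)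
have [u1 | u1] := eqVneq u (inord 1).
  by have := dom (inord 2); rewrite u1 -!val_eqE /= !inordK // => /(_ isT isT).
rewrite eq_sym in u1; have := dom (inord 1); rewrite u1 -val_eqE /= inordK //.
by move/(_ isT isT).
Qed.

Lemma no_full_vertex_complete_bipartite (p q : nat) (v : complete_bipartite p q) :
  1 < p -> 1 < q -> ~~ full_vertex v.
Proof.
have other n (i : 'I_n) : 1 < n -> exists j, j != i.
  by rewrite -[n in 1 < n]card_ord => /card_gt1P[a [b [_ _]]];
     have [<-|] := eqVneq a i; [rewrite eq_sym; exists b | exists a].
case: v => i p1 q1; apply/negP=> /forallP.
  by have [j ji] := other _ i p1 => /(_ (inl j));
     rewrite /= inj_eq ?ji // => ? ? [].
by have [j ji] := other _ i q1 => /(_ (inr j));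
   rewrite /= inj_eq ?ji // => ? ? [].
Qed.

Lemma ord2_third (i j k : 'I_2) : i != j -> k != i -> k != j -> False.
Proof. by case: i j k => [[|[|//]] ?] [[|[|//]] ?] [[|[|//]] ?]. Qed.

(** The two left vertices form a whole side, and a pair with one vertex on each side dominates both
    sides. Two right vertices dominate the left side but no further right vertex, so they suffice
    only when they are the whole right side. *)
Lemma dominating_complete_bipartite (m : nat) (u v : complete_bipartite 2 m) :
    u != v ->
  dominating [set u; v] =
    (if u is inl _ then true else if v is inl _ then true else m == 2).
Proof.
case: u v => i [] j uv.
- apply/dominating2P=> -[k|//]; rewrite !(inj_eq (@inl_inj _ _)) => ki kj.
  by case: (ord2_third uv ki kj).
- by apply/dominating2P=> -[].
- by apply/dominating2P=> -[].
have [m2 | m2] := eqVneq m 2.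
  apply/dominating2P=> -[//|k]; rewrite !(inj_eq (@inr_inj _ _)).
  by subst m => ki kj; case: (ord2_third uv ki kj).
have ij : i != j by [].
have : 0 < #|~: [set i; j]|.
  have := cardsC [set i; j]; rewrite cards2 ij card_ord => cm.
  by rewrite lt0n; apply: contraNneq m2 => c0; rewrite -cm c0.
case/card_gt0P=> k; rewrite !inE negb_or => /andP[ki kj].
by apply/dominating2P=> /(_ (inr k) ki kj).
Qed.

Lemma singleton_coalition_complete_bipartite (m : nat)
    (u v : complete_bipartite 2 m) : 1 < m ->
  singleton_coalition u v =
    (u != v) &&
    (if u is inl _ then true else if v is inl _ then true else m == 2).
Proof.
move=> m1; rewrite singleton_coalitionE !no_full_vertex_complete_bipartite //=.
by have [//|uv] := eqVneq u v; exact: dominating_complete_bipartite.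
Qed.

Lemma SP_graph_complete_bipartite (m : nat) :
  1 < m -> SP_graph (complete_bipartite 2 m).
Proof.
move=> m1; apply/SP_graphP=> v; right.
case: v => [i|j]; [exists (inr (Ordinal (ltnW m1))) | exists (inl ord0)];
  by rewrite singleton_coalition_complete_bipartite.
Qed.

(** In [complete_bipartite 2 2] every two distinct vertices form a coalition, so any bijection from
    [complete_graph 4] is an isomorphism. *)
Lemma SC_step_cycle4 : SC_step (cycle_graph 4) (complete_graph 4).
Proof.
apply: SC_step_iso (iso_sym cycle4_iso) _.
apply/SC_stepP; split; first exact: SP_graph_complete_bipartite.
have card22 : #|complete_bipartite 2 2| = 4 by rewrite card_sum !card_ord.
pose f (i : complete_graph 4) :
    singleton_coalition_graph (complete_bipartite 2 2) :=
  enum_val (cast_ord (esym card22) i).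
have inj_f : injective f by move=> i j /enum_val_inj/cast_ord_inj.
apply: (inj_card_iso inj_f) => [|i j]; first by rewrite [leqLHS]card22 card_ord.
rewrite /= singleton_coalition_complete_bipartite // (inj_eq inj_f).
by case: (f i) (f j) => ? []; rewrite andbT.
Qed.

(** The left vertices become adjacent to each other while the right side stays independent, since
    [m] is not 2. One left vertex plays the part of the joined single vertex, the other that of the
    centre of the star. *)
Lemma SC_step_complete_bipartite (m : nat) : 2 < m ->
  SC_step (complete_bipartite 2 m)
          (join (complete_graph 1) (complete_bipartite 1 m)).
Proof.
move=> m2; have m1 := ltnW m2.
apply/SC_stepP; split; first exact: SP_graph_complete_bipartite.
pose f (a : join (complete_graph 1) (complete_bipartite 1 m)) :
    singleton_coalition_graph (complete_bipartite 2 m) :=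
  match a with
  | inl _ => inl ord0 | inr (inl _) => inl ord_max | inr (inr j) => inr j
  end.
apply: (@inj_card_iso _ _ f).
- by case=> [i|[i|i]] [j|[j|j]] //= => [_|_|[->]] //; rewrite (ord1 i) (ord1 j).
- by rewrite !card_sum !card_ord.
have m'2 : (m == 2) = false by rewrite gtn_eqF.
case=> [i|[i|i]] [j|[j|j]];
  rewrite /= singleton_coalition_complete_bipartite ?m'2 ?andbF ?andbT //=.
by rewrite (ord1 i) (ord1 j).
Qed.

(** Only the [m] independent vertices are not full, so a partner of one of them is another one; such
    a pair leaves a third undominated. *)
Lemma not_SP_join_star (m : nat) : 2 < m ->
  ~~ SP_graph (join (complete_graph 1) (complete_bipartite 1 m)).
Proof.
case: m => [|[|[|m]]] // _.
set G := join _ _.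
have full_inl (i : 'I_1) : full_vertex (inl i : G).
  by apply/forallP=> -[j|//]; rewrite (ord1 i) (ord1 j).
have full_inr (i : 'I_1) : full_vertex (inr (inl i) : G).
  by apply/forallP=> -[//|[j|//]]; rewrite (ord1 i) (ord1 j).
apply/negP=> /SP_graphP/(_ (inr (inr ord0))) [|[u]].
  by move/forallP/(_ (inr (inr ord_max))).
rewrite singleton_coalitionE => /and4P[_ _ nu /dominating2P dom].
case: u nu dom => [i|[i|k]]; rewrite ?full_inl ?full_inr // => _ dom.
(* At least one of the indices 1 and [ord_max] differs from [k], and neither is 0. *)
have := dom (inr (inr ord_max)); have := dom (inr (inr (inord 1))).
rewrite /= !(inj_eq (@inr_inj _ _)) -!val_eqE /= inordK //.
have [k1 _ | _ /(_ isT isT)//] := eqVneq 1 (val k).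
by rewrite -k1 => /(_ isT isT).
Qed.

(** * Extracting a leaf, and an obstruction to being an SP-graph *)

Lemma min_degree_le (G : sgraph) (v : G) : min_degree G <= degree v.
Proof.
rewrite /min_degree; elim: (index_enum G) (mem_index_enum v) => // u s IHs.
rewrite in_cons big_cons geq_min => /predU1P[-> | /IHs->]; last exact: orbT.
by rewrite leqnn.
Qed.

Lemma min_degree1_leaf (G : sgraph) :
  min_degree G = 1 -> exists x y : G, forall v, adj x v = (v == y).
Proof.
move=> min1; case: (pickP (fun v : G => degree v == 1)) => [x | deg].
  case/cards1P=> y /setP xy; exists x, y => v.
  by have := xy v; rewrite !inE.
have deg2 (v : G) : 1 < degree v.
  by rewrite ltn_neqAle eq_sym deg -min1 min_degree_le.
suff: 1 < min_degree G by rewrite min1.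
rewrite /min_degree; elim/big_ind: _ => // [|a b a1 b1]; last first.
  by rewrite leq_min a1.
(* The default value [#|G|] must exceed 1 as well: it bounds any degree, and on an empty graph the
   minimum would be 0. *)
case: (pickP (predT : pred G)) => [v _ | G0].
  exact: leq_trans (deg2 v) (max_card _).
by move: min1; rewrite /min_degree big_pred0 // eq_card0.
Qed.

(** A partner [u] of [q] has to be [x] or a neighbour of [x], because [q] does not dominate [x]. A
    neighbour of [x] lies outside the pair and differs from [q'], so by independence neither it nor
    [q] dominates [q']; and [x] does not dominate [q'] either. *)
Lemma not_SP_pair_cover (G : sgraph) (x y q q' : G) :
    (forall u v : G, adj u v -> (u \in [set x; y]) (+) (v \in [set x; y])) ->
    q \notin [set x; y] -> q' \notin [set x; y] -> q != q' ->
    ~~ adj x q -> ~~ adj x q' ->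
  ~~ SP_graph G.
Proof.
move=> bip q_xy q'_xy qq' xq xq'; have [x_xy y_xy] := (set21 x y, set22 x y).
have nadj u v : u \notin [set x; y] -> v \notin [set x; y] -> ~~ adj u v.
  by move=> /negbTE nu /negbTE nv; apply/negP=> /bip; rewrite nu nv.
have nx v : v \notin [set x; y] -> x != v by apply: contraNneq => <-.
apply/negP=> /SP_graphP/(_ q) [/forallP/(_ x) | [u]].
  by rewrite nx //= adj_sym (negbTE xq).
rewrite singleton_coalitionE => /and4P[qu _ _ /dominating2P dom].
have xu : ~~ adj x u.
  apply/negP=> xu; have := bip _ _ xu; rewrite x_xy /= => u_xy.
  have [q'u | q'u] := eqVneq q' u; first by rewrite -q'u (negbTE xq') in xu.
  have := dom q' _ q'u; rewrite eq_sym qq' => /(_ isT).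
  by rewrite (negbTE (nadj _ _ q'_xy q_xy)) (negbTE (nadj _ _ q'_xy u_xy)).
have [eux | ux] := eqVneq u x; last first.
  have := dom x (nx _ q_xy); rewrite eq_sym => /(_ ux).
  by rewrite (negbTE xq) (negbTE xu).
have := dom q'; rewrite eq_sym => /(_ qq'); rewrite eux eq_sym nx // => /(_ isT).
by rewrite (negbTE (nadj _ _ q'_xy q_xy)) adj_sym (negbTE xq').
Qed.

(** * Coalitions in an SP-graph without full vertices that has a leaf [x] with neighbour [y] *)

Section LeafCoalitions.
Variables (G : sgraph) (x y : G).
Hypothesis SP_G : SP_graph G.
Hypothesis nfull : forall v : G, ~~ full_vertex v.
Hypothesis leaf : forall v, adj x v = (v == y).

Lemma leaf_neq : x != y.
Proof. by rewrite -leaf adj_irr. Qed.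

Lemma leaf_coalitionE (u v : G) :
  singleton_coalition u v = (u != v) && dominating [set u; v].
Proof. by rewrite singleton_coalitionE !nfull. Qed.

(** The leaf [x] is dominated only by itself and by [y]. *)
Lemma leaf_coalition_meets (u v : G) :
  singleton_coalition u v -> (u \in [set x; y]) || (v \in [set x; y]).
Proof.
rewrite leaf_coalitionE !inE => /andP[_ /dominating2P/(_ x)].
rewrite !leaf ![x == _]eq_sym.
by case: (u == x); case: (v == x); rewrite ?orbT //=;
   move=> /(_ isT isT)/orP[]->; rewrite ?orbT.
Qed.

(** Since [x] dominates nothing beyond [x] and [y], domination by the pair would make [y] full. *)
Lemma leaf_coalition_pair : ~~ singleton_coalition x y.
Proof.
rewrite leaf_coalitionE leaf_neq; apply: contraNN (nfull y) => /dominating2P dom.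
apply/forallP=> u; apply/implyP=> uy; have [-> | ux] := eqVneq u x.
  by rewrite adj_sym leaf.
by have := dom u ux uy; rewrite adj_sym leaf (negbTE uy) adj_sym.
Qed.

(** The closed neighbourhood of [x] is contained in that of [y], so [y] may replace [x] in a
    dominating pair. *)
Lemma leaf_coalition_neighbour (v : G) :
  singleton_coalition x v -> singleton_coalition y v.
Proof.
move=> xv; have vy : y != v.
  by apply: contraTneq xv => <-; exact: leaf_coalition_pair.
move: xv; rewrite !leaf_coalitionE vy => /andP[_ /dominating2P dom].
apply/dominating2P=> z zy zv; have [-> | zx] := eqVneq z x.
  by rewrite leaf eqxx.
by have := dom z zx zv; rewrite adj_sym leaf (negbTE zy) => /= ->; rewrite orbT.
Qed.

(** The SP hypothesis gives a vertex outside the pair some partner, which must be [x] or [y]; if it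
    is [x], then [y] is a partner too. *)
Lemma leaf_coalition_y (v : G) :
  singleton_coalition y v = (v \notin [set x; y]).
Proof.
apply/idP/idP => [yv | ].
  rewrite !inE negb_or; apply/andP; split; apply: contraTneq yv => ->.
    by rewrite [singleton_coalition _ _]coalition_sym leaf_coalition_pair.
  by rewrite leaf_coalitionE eqxx.
move=> v_xy; move/SP_graphP/(_ v): SP_G => [full|[u vu]].
  by rewrite (negbTE (nfull v)) in full.
have := leaf_coalition_meets vu; rewrite (negbTE v_xy) /=.
move: vu; rewrite [singleton_coalition _ _]coalition_sym => uv.
case/set2P=> eq_u; rewrite eq_u in uv => //.
exact: leaf_coalition_neighbour.
Qed.

(** Outside the pair [x] dominates nothing, so [v] has to dominate everything there alone. This
    turns coalition with [x] into adjacency in [G]. *)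
Lemma leaf_coalition_xP (v : G) : v \notin [set x; y] ->
  reflect (forall z, z \notin [set x; y] -> z != v -> adj z v)
          (singleton_coalition x v).
Proof.
rewrite !inE negb_or => /andP[vx vy].
rewrite leaf_coalitionE eq_sym vx.
apply: (iffP (dominating2P x v)) => dom z; rewrite ?inE ?negb_or.
  case/andP=> zx zy zv; have := dom z zx zv.
  by rewrite adj_sym leaf (negbTE zy).
move=> zx zv; rewrite adj_sym leaf; have [//|zy] := eqVneq z y.
by apply: dom => //; rewrite !inE negb_or zx.
Qed.

(** Each other [z] outside the pair is a partner of [y]; as [y] does not dominate [w], [z] must be
    adjacent to [w]. *)
Lemma leaf_coalition_undominated (w : G) :
  w != y -> ~~ adj y w -> singleton_coalition x w.
Proof.
move=> wy yw.
have wx : w != x by apply: contraNneq yw => ->; rewrite adj_sym leaf.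
apply/leaf_coalition_xP; first by rewrite !inE negb_or wx.
move=> z z_xy zw; have := z_xy; rewrite -leaf_coalition_y leaf_coalitionE.
case/andP=> _ /dominating2P/(_ w wy); rewrite eq_sym => /(_ zw).
by rewrite adj_sym (negbTE yw) adj_sym.
Qed.

(** By [leaf_coalition_xP], [q] fails because of a non-neighbour outside the pair; non-adjacency
    being symmetric, that vertex fails because of [q]. Hence [Q] in the family is never a single
    vertex. *)
Lemma leaf_coalition_missed (q : G) :
    q \notin [set x; y] -> ~~ singleton_coalition x q ->
  exists q', [/\ q' \notin [set x; y], q' != q & ~~ singleton_coalition x q'].
Proof.
move=> q_xy nq.
pose P := [pred z | [&& z \notin [set x; y], z != q & ~~ adj z q]].
case: (pickP P) => [z /and3P[z_xy zq nzq] | none].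
  exists z; split=> //; apply: contraNN nzq => /leaf_coalition_xP dom.
  by rewrite adj_sym dom // eq_sym.
case/negP: nq; apply/leaf_coalition_xP=> // z z_xy zq.
by have := none z; rewrite /= z_xy zq => /negbFE.
Qed.

Lemma leaf_coalition_bipartite (u v : G) :
  singleton_coalition u v -> (u \in [set x; y]) (+) (v \in [set x; y]).
Proof.
move=> uv; have := leaf_coalition_meets uv.
have irr (w : G) : ~~ singleton_coalition w w by rewrite leaf_coalitionE eqxx.
have yx : ~~ singleton_coalition y x.
  by rewrite [singleton_coalition _ _]coalition_sym leaf_coalition_pair.
have [|u_xy] := boolP (u \in [set x; y]);
  have [|v_xy] := boolP (v \in [set x; y]) => //.
case/set2P=> eq_v /set2P[] eq_u; move: uv; rewrite eq_u eq_v.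
- by rewrite (negbTE (irr x)).
- by rewrite (negbTE yx).
- by rewrite (negbTE leaf_coalition_pair).
- by rewrite (negbTE (irr y)).
Qed.

Lemma leaf_coalition_H1 :
  (forall v : G, 0 < degree v) -> in_H1 (singleton_coalition_graph G).
Proof.
move=> deg_gt0.
(* As [y] is not full, it has a non-neighbour, which serves as [w]. *)
have [w wy yw] : exists2 w, w != y & ~~ adj y w.
  have := nfull y; rewrite negb_forall => /existsP[w].
  by rewrite negb_imply => /andP[]; exists w.
have xw := leaf_coalition_undominated wy yw.
have x_sub v : singleton_coalition x v -> v \notin [set x; y].
  by rewrite -leaf_coalition_y; exact: leaf_coalition_neighbour.
have w_xy := x_sub w xw.
(* [P] collects the remaining partners of [x], and [Q] the vertices outside the pair that are not
   partners of [x]. *)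
pose P := [set v : G | singleton_coalition x v] :\ w.
pose Q := [set v : G | (v \notin [set x; y]) && ~~ singleton_coalition x v].
have PwE : P :|: [set w] = [set v | singleton_coalition x v].
  by rewrite setUC setD1K // inE.
have BE : P :|: [set w] :|: Q = ~: [set x; y].
  rewrite PwE; apply/setP=> v; rewrite !inE -in_set2.
  by have [/x_sub -> | ] := boolP (singleton_coalition x v); rewrite ?andbT.
exists x, y, w, P, Q; rewrite /= !BE; do !split.
- exact: leaf_neq.
- exact: setUCr.
- by rewrite disjoints_subset setCK.
- by rewrite !inE eqxx.
- by rewrite inE xw andbF.
- rewrite disjoints_subset; apply/subsetP=> v; rewrite !inE => /andP[_ ->].
  by rewrite andbF.
(* A neighbour of [w] in [G] is neither [x], whose only neighbour is [y], nor [y], so it lies in [P]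
   or [Q]. *)
- have /card_gt0P[u] := deg_gt0 w; rewrite inE => wu.
  apply/card_gt0P; exists u.
  have uw : u != w by apply: contraTneq wu => ->; rewrite adj_irr.
  have : u \in P :|: [set w] :|: Q.
    rewrite BE !inE negb_or; apply/andP; split; apply: contraTneq wu => ->.
      by rewrite adj_sym leaf.
    by rewrite adj_sym.
  by rewrite !inE (negbTE uw) orbF.
- case/set0Pn=> q; rewrite inE => /andP[q_xy nq].
  have [q' [q'_xy q'q nq']] := leaf_coalition_missed q_xy nq.
  by apply/card_gt1P; exists q', q; rewrite !inE -!in_set2 q_xy q'_xy nq nq'.
- by move=> v; rewrite PwE inE.
- by move=> v; rewrite leaf_coalition_y in_setC.
- move=> u v; rewrite !inE -!in_set2 => /negbTE u_xy /negbTE v_xy.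
  by apply/negP=> /leaf_coalition_bipartite; rewrite u_xy v_xy.
Qed.

Lemma leaf_coalition_not_SP (q : G) :
    q \notin [set x; y] -> ~~ singleton_coalition x q ->
  ~~ SP_graph (singleton_coalition_graph G).
Proof.
move=> q_xy nq; have [q' [q'_xy q'q nq']] := leaf_coalition_missed q_xy nq.
apply: (@not_SP_pair_cover (singleton_coalition_graph G) x y q q') => //.
  exact: leaf_coalition_bipartite.
by rewrite eq_sym.
Qed.

Lemma leaf_coalition_complete_bipartite :
    (forall v, v \notin [set x; y] -> singleton_coalition x v) ->
  iso (complete_bipartite 2 (#|G| - 2)) (singleton_coalition_graph G).
Proof.
move=> x_all; pose A : {set singleton_coalition_graph G} := [set x; y].
have cA : #|A| = 2 by rewrite cards2 leaf_neq.
have cA' : #|~: A| = #|G| - 2 by rewrite -(cardsC A) cA addKn.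
rewrite -{1}cA -cA'; apply: complete_bipartite_iso => u v.
apply/idP/idP; first exact: leaf_coalition_bipartite.
have A_all (a b : G) : a \in A -> b \notin A -> singleton_coalition a b.
  by case/set2P=> -> b_xy; [exact: x_all | rewrite leaf_coalition_y].
case: (boolP (u \in A)) (boolP (v \in A)) => uA [] vA // _; first exact: A_all.
by rewrite adj_sym; exact: A_all.
Qed.

End LeafCoalitions.

(** * Assembling the three chains *)

Lemma in_H1_card (H : sgraph) : in_H1 H -> 3 < #|H|.
Proof.
case=> x [y [w [P [Q [[xy AB dAB] [[wP wQ _] [PQ _]]]]]]].
rewrite -cardsT -AB cardsU disjoint_setI0 // cards0 subn0 cards2 xy.
by rewrite (setUAC P) [P :|: Q :|: _]setUC cardsU1 in_setU negb_or wP wQ.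
Qed.

Theorem theorem10 (G : sgraph) (n : nat)
    (order_G : #|G| = n)
    (SP_G : SP_graph G)
    (delta_G : min_degree G = 1)
    (no_full_vertex : ~ exists v : G, full_vertex v) :
  (exists H1 : sgraph, in_H1 H1 /\ SC_chain G [:: H1])
  \/ SC_chain G [:: cycle_graph 4; complete_graph 4; edgeless_graph 4]
  \/ SC_chain G [:: complete_bipartite 2 (n - 2);
                    join (complete_graph 1) (complete_bipartite 1 (n - 2))].
Proof.
have nfull (v : G) : ~~ full_vertex v.
  by apply/negP=> v_full; apply: no_full_vertex; exists v.
have deg_gt0 (v : G) : 0 < degree v by rewrite -delta_G min_degree_le.
have [x [y leaf]] := min_degree1_leaf delta_G.
have H1 := leaf_coalition_H1 SP_G nfull leaf deg_gt0.
(* A vertex outside the pair that is not a partner of [x] gives chain (a); if there is none, the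
   successor is complete bipartite. *)
have [q /andP[q_xy nq] | x_all] :=
    pickP [pred q | (q \notin [set x; y]) && ~~ singleton_coalition x q].
  left; exists (singleton_coalition_graph G); split=> //.
  apply: SC_chain_cons.
    by apply/SC_stepP; split=> //; exists id => //; exists id.
  apply: SC_chain_nil; exact: (leaf_coalition_not_SP nfull leaf q_xy nq).
have isoK : iso (complete_bipartite 2 (n - 2)) (singleton_coalition_graph G).
  rewrite -order_G.
  apply: (leaf_coalition_complete_bipartite SP_G nfull leaf) => v v_xy.
  by have := x_all v; rewrite /= v_xy => /negbFE.
(* The successor has the vertices of [G] and lies in the family in either case, so [G] has at least
   four vertices. *)
have n2 : 1 < n - 2.
  by rewrite ltn_subRL -order_G; exact: in_H1_card H1.
(* Two right vertices form a coalition exactly when they are the whole right side; this separates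
   (b) from (c). *)
right; have [m2 | m2] := eqVneq (n - 2) 2.
  left; apply: SC_chain_cons.
    apply/SC_stepP; split=> //; apply: iso_trans cycle4_iso _.
    by rewrite m2 in isoK.
  apply: SC_chain_cons SC_step_cycle4 _.
  apply: SC_chain_cons (SC_step_complete 4) _.
  exact/SC_chain_nil/edgeless4_not_SP.
have {m2}n2 : 2 < n - 2 by rewrite ltn_neqAle eq_sym m2.
right; apply: SC_chain_cons; first exact/SC_stepP.
apply: SC_chain_cons (SC_step_complete_bipartite n2) _.
exact/SC_chain_nil/not_SP_join_star.
Qed.
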